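(* Let $w$ be a non-empty word on the alphabet $\{0,1\}$, let $|w|$ denote its length, let $v_2(w)$ denote its value as a binary expansion, let $N_{w,2}(n)$ be the number of (possibly overlapping) occurrences of $w$ in the binary expansion of $n$, let $\gamma$ be Euler's constant, let $\Gamma$ be the gamma function and let $\Psi = \Gamma'/\Gamma$. (a) If $v_2(w) = 0$, then $$\sum_{n \geq 1} \frac{N_{w,2}(n)}{2n(2n+1)(2n+2)} = \log \Gamma\left(\frac{1}{2^{|w|}}\right) + \frac{\gamma}{2^{|w|+1}} - |w| \log 2 - \frac{1}{2^{|w|+1}}\Psi\left(\frac{1}{2^{|w|}}\right) - \frac{1}{2}.$$ (b) If $v_2(w) \neq 0$, then $$\sum_{n \geq 1} \frac{N_{w,2}(n)}{2n(2n+1)(2n+2)} = \log \Gamma\left(\frac{v_2(w)+1}{2^{|w|}}\right) - \log \Gamma\left(\frac{v_2(w)}{2^{|w|}}\right) - \frac{1}{2^{|w|+1}} \left(\Psi\left(\frac{v_2(w)}{2^{|w|}}\right) + \Psi\left(\frac{v_2(w)+1}{2^{|w|}}\right)\right).$$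
   Context: A word on $\{0,1\}$ is a finite block of digits $w = d_1 d_2 \cdots d_k$; its length is $|w| = k$, and $v_2(w) = \sum_{i=1}^k d_i 2^{k-i}$ is the value of $w$ interpreted as a base-2 expansion (possibly with leading $0$'s). For an integer $n>0$, $N_{w,2}(n)$ is the number of (possibly overlapping) occurrences of $w$ as a block of consecutive digits in the binary expansion of $n$. Convention: if $w$ begins with $0$ but $v_2(w) \neq 0$, then in computing $N_{w,2}(n)$ the binary expansion of $n$ is assumed to start with an arbitrarily long prefix of $0$'s; if $v_2(w) = 0$ (i.e. $w$ consists only of $0$'s), the usual binary expansion of $n$ without leading zeros is used. For example $N_{11,2}(7)=2$, $N_{011,2}(3) = 1$ and $N_{0,2}(2)=1$. *)

(* Defs.v *)
From mathcomp Require Import all_boot all_order all_algebra.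
From mathcomp Require Import all_classical all_reals all_analysis.

Set Implicit Arguments.
Unset Strict Implicit.
Unset Printing Implicit Defensive.

Import Order.TTheory GRing.Theory Num.Theory.
Import numFieldNormedType.Exports.

(* Words on {0,1} are [seq bool], most significant digit first. *)

Definition v2 (w : seq bool) : nat :=
  \sum_(i < size w) nth false w i * 2 ^ (size w - i.+1).

(* For n > 0, without leading zeros; the value at n = 0 is never used. *)
Definition binary_expansion (n : nat) : seq bool :=
  rev (mkseq (fun i => odd (n %/ 2 ^ i)) (trunc_log 2 n).+1).

(* Number of starting positions, so that occurrences may overlap. *)
Definition occurrences (w s : seq bool) : nat :=
  count (fun i => prefix w (drop i s)) (iota 0 (size s)).

(* When w begins with 0 and v2 w != 0, the expansion of n is preceded by
   arbitrarily many zeros; [size w] of them are enough, see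
   [occurrences_padding]. *)
Definition block_count (w : seq bool) (n : nat) : nat :=
  if ~~ head true w && (v2 w != 0) then
    occurrences w (nseq (size w) false ++ binary_expansion n)
  else occurrences w (binary_expansion n).

Lemma v2_nseq0 (k : nat) : v2 (nseq k false) = 0.
Proof. by rewrite /v2 big1 // => i _; rewrite nth_nseq if_same. Qed.

Lemma occurrences_padding (w s : seq bool) (m : nat) :
  v2 w != 0 -> size w <= m ->
  occurrences w (nseq m false ++ s) = occurrences w (nseq (size w) false ++ s).
Proof.
move=> w0 /subnKC <-; elim: (m - size w) => [|d <-]; first by rewrite addn0.
rewrite addnS /occurrences /= (iotaDl 1 0) count_map.
rewrite -[X in _ = X]add0n; congr (_ + _)%N.
rewrite -[LHS]/(nat_of_bool (prefix w (nseq (size w + d).+1 false ++ s))).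
apply/eqP; rewrite eqb0 prefixE; apply: contra w0 => /eqP <-.
by rewrite takel_cat ?size_nseq ?take_nseq ?v2_nseq0 // -addnS leq_addr.
Qed.

Example block_count_11_7 : block_count [:: true; true] 7 = 2.
Proof. by []. Qed.

Example block_count_0_2 : block_count [:: false] 2 = 1.
Proof. by rewrite /block_count /v2 big_ord_recl big_ord0. Qed.

Example block_count_011_3 : block_count [:: false; true; true] 3 = 1.
Proof. by rewrite /block_count /v2 !big_ord_recl big_ord0. Qed.

Local Open Scope classical_set_scope.
Local Open Scope ring_scope.

Definition euler_gamma (R : realType) : R :=
  limn (fun n : nat => \sum_(1 <= k < n.+1) (k%:R : R)^-1 - ln (n%:R : R)).

(* Euler's integral; only used for x > 0, where it converges. *)
Definition Gamma (R : realType) (x : R) : R :=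
  \int[lebesgue_measure]_(t in `]0, +oo[) (t `^ (x - 1) * expR (- t)).

Definition Psi (R : realType) (x : R) : R := derive1 (@Gamma R) x / Gamma x.

(* Main.v *)
Require Import Defs.
From mathcomp Require Import all_boot all_order all_algebra.
From mathcomp Require Import all_classical all_reals all_analysis.
From mathcomp Require Import measurable_realfun ring lra zify.

Set Implicit Arguments.
Unset Strict Implicit.
Unset Printing Implicit Defensive.

Import Order.TTheory GRing.Theory Num.Theory.
Import numFieldNormedType.Exports.

Local Open Scope classical_set_scope.
Local Open Scope ring_scope.

(** Put eta m = (1/m + 1/(m+1))/2 - log((m+1)/m).  The logarithms cancel in
    eta n - eta (2n) - eta (2n+1), which equals 1/(2n(2n+1)(2n+2)).  Since
    N_w(m) - N_w(floor(m/2)) is 1 or 0 according to whether m = v_2(w) modulo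
    2^|w|, summation by parts turns the series into the sum of eta over that
    residue class; the boundary term vanishes because eta m = O(1/m^2) and
    N_w(m) = O(sqrt m).  The sum over a residue class is evaluated with Gauss'
    product for Gamma and the corresponding series for Psi.  When v_2(w) = 0 the
    positive members of the class start at 2^|w|, so the same evaluation applies
    with 2^|w| in place of v_2(w).

    Gauss' product follows from Gamma(s + y) <= s^y Gamma(s) for 0 <= y <= 1 (a
    tangent-line inequality under the integral sign) and the functional
    equation.  The derivative of log Gamma comes from a quadratic remainder
    estimate for the partial products, uniform in n. *)

(** * Euler's integral *)

Section GammaIntegral.
Variable R : realType.
Implicit Types (x t : R) (n : nat).

Local Notation mu := (@lebesgue_measure R).

Definition gamma_kernel x t : R := t `^ (x - 1) * expR (- t).

(* Compact exhaustion of ]0, +oo[, keeping away from the singularity of the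
   kernel at 0 (when x < 1) as well as from infinity. *)
Definition exhaustion n : set R := `[n.+2%:R^-1, n.+2%:R].

Lemma exhaustion_gt0 n t : exhaustion n t -> 0 < t.
Proof.
rewrite /exhaustion/= in_itv/= => /andP[+ _]; apply: lt_le_trans.
by rewrite invr_gt0 ltr0n.
Qed.

Lemma bigcup_exhaustion : \bigcup_n exhaustion n = (`]0, +oo[%classic : set R).
Proof.
apply/seteqP; split => [t [n _ /exhaustion_gt0 t0]|t].
  by rewrite /= in_itv/= t0.
rewrite /= in_itv/= andbT => t0.
have [n tn] : exists n, Num.max t t^-1 <= n%:R.
  exists (Num.truncn (Num.max t t^-1)).+1.
  by apply/ltW/truncnS_gt.
move: tn; rewrite ge_max => /andP[tn tVn].
have nS : n%:R <= n.+2%:R :> R by rewrite ler_nat; lia.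
exists n => //; rewrite /exhaustion/= in_itv/=; apply/andP; split.
  by rewrite invf_ple ?posrE ?ltr0n// (le_trans tVn).
by rewrite (le_trans tn).
Qed.

Lemma nondecreasing_exhaustion : nondecreasing_seq exhaustion.
Proof.
apply/nondecreasing_seqP => n; rewrite subsetEset /exhaustion.
apply: subset_itv; rewrite bnd_simp.
  by rewrite lef_pV2 ?posrE ?ltr0n// ler_nat.
by rewrite ler_nat.
Qed.

(** Monotone convergence in the extended reals, so that it can be used before the Gamma integral is
    known to be finite. *)
Lemma cvg_integral_exhaustion (f : R -> R) :
  (forall t, 0 < t -> 0 <= f t) -> {in `]0, +oo[%R, continuous f} ->
  (\int[mu]_(t in exhaustion n) (f t)%:E)%E @[n --> \oo] -->
  (\int[mu]_(t in `]0%R, +oo[) (f t)%:E)%E.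
Proof.
move=> f0 cf; rewrite -bigcup_exhaustion.
apply: ge0_nondecreasing_set_cvg_integral.
- exact: nondecreasing_exhaustion.
- by move=> n; exact: measurable_itv.
- move=> n; apply/measurable_EFinP.
  have mf : measurable_fun (`]0, +oo[%classic : set R) f.
    by apply: open_continuous_measurable_fun => // t; rewrite inE/=; exact: cf.
  apply: (measurable_funS _ _ mf); first exact: measurable_itv.
  by move=> t tn; rewrite /= in_itv/= (exhaustion_gt0 tn).
- by move=> n t tn; rewrite lee_fin f0// (exhaustion_gt0 tn).
Qed.

Lemma gamma_kernel_ge0 x t : 0 <= gamma_kernel x t.
Proof. by rewrite mulr_ge0 ?powR_ge0 ?expR_ge0. Qed.

Lemma continuous_gamma_kernel x : {in `]0, +oo[%R, continuous (gamma_kernel x)}.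
Proof.
move=> t t0; apply: cvgM.
  by have /derivable1_diffP/differentiable_continuous := @derivable_powR _ 1 (x - 1) t t0.
apply: (@continuous_comp _ _ _ (fun t => - t) expR); last exact: continuous_expR.
exact: opp_continuous.
Qed.

Lemma measurable_gamma_kernel x : measurable_fun (`]0, +oo[%classic : set R) (gamma_kernel x).
Proof.
apply: open_continuous_measurable_fun => // t; rewrite inE/= => t0.
exact: continuous_gamma_kernel.
Qed.

(** * Functional equation by integration by parts *)

Definition gamma_prim x t : R := t `^ x * expR (- t).

Lemma is_derive_gamma_prim x t : 0 < t ->
  is_derive t 1 (gamma_prim x) (x * gamma_kernel x t - gamma_kernel (x + 1) t).
Proof.
move=> t0.
have dp : is_derive t 1 (@powR R ^~ x) (x * t `^ (x - 1)) by exact: is_derive1_powR.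
have de : is_derive t 1 (fun t => expR (- t)) (- expR (- t)).
  by apply: is_derive_eq; rewrite /GRing.scale/= mulrN1.
have := is_deriveM dp de; rewrite /gamma_prim => h; apply: is_derive_eq h _.
rewrite /gamma_kernel addrK /GRing.scale/=; ring.
Qed.

Lemma integrable_exhaustion (f : R -> R) n : {in `]0, +oo[%R, continuous f} ->
  mu.-integrable (exhaustion n) (EFin \o f).
Proof.
move=> cf; apply: continuous_compact_integrable; first exact: segment_compact.
apply: continuous_in_subspaceT => t; rewrite inE => /exhaustion_gt0 t0.
by apply: cf; rewrite in_itv/= t0.
Qed.

(** Integration by parts, with [gamma_prim x] as boundary term. It is applied with [x > 0] for the
    functional equation and with [x = 0] for the value at 1. *)
Lemma Rintegral_gamma_kernelS x n :
  x * \int[mu]_(t in exhaustion n) gamma_kernel x t =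
  \int[mu]_(t in exhaustion n) gamma_kernel (x + 1) t +
  (gamma_prim x n.+2%:R - gamma_prim x n.+2%:R^-1).
Proof.
have ckx := @continuous_gamma_kernel x.
have ckx1 := @continuous_gamma_kernel (x + 1).
rewrite -RintegralZl//; [|exact: measurable_itv|exact: integrable_exhaustion].
apply/eqP; rewrite addrC -subr_eq -RintegralB//; first last.
- exact: integrable_exhaustion.
- apply: (@integrable_exhaustion (fun t => x * gamma_kernel x t)) => t t0.
  by apply: cvgM; [exact: cvg_cst|exact: ckx].
- exact: measurable_itv.
apply/eqP; rewrite /Rintegral.
have n2 : (n.+2%:R^-1 < n.+2%:R :> R).
  by rewrite (@lt_trans _ _ 1) ?invf_lt1 ?ltr0n ?ltr1n.
have n0 : 0 < (n.+2%:R^-1 : R) by rewrite invr_gt0 ltr0n.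
rewrite (@continuous_FTC2 _ _ (gamma_prim x))//=.
- apply: continuous_in_subspaceT => t; rewrite inE => /exhaustion_gt0 t0.
  have t0' : t \in `]0, +oo[%R by rewrite in_itv/= t0.
  by apply: cvgB; [apply: cvgM; [exact: cvg_cst|exact: ckx]|exact: ckx1].
- split.
  + move=> t; rewrite in_itv/= => /andP[t1 _].
    by have [] := @is_derive_gamma_prim x t (lt_trans n0 t1).
  + apply: cvg_at_right_filter.
    have [+ _] := @is_derive_gamma_prim x _ n0.
    by move=> /derivable1_diffP/differentiable_continuous.
  + apply: cvg_at_left_filter.
    have [+ _] := @is_derive_gamma_prim x n.+2%:R (lt_trans n0 n2).
    by move=> /derivable1_diffP/differentiable_continuous.
- move=> t; rewrite in_itv/= => /andP[t1 _].
  by rewrite derive1E; have [_ ->] := @is_derive_gamma_prim x t (lt_trans n0 t1).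
Qed.

Lemma cvg_invSS : (n.+2%:R^-1 : R) @[n --> \oo] --> (0 : R).
Proof.
apply/cvgrPdist_le => e e0; near=> n.
rewrite sub0r normrN ger0_norm ?invr_ge0// invf_ple ?posrE ?ltr0n//.
rewrite (@le_trans _ _ n%:R)// ?ler_nat; last by lia.
by near: n; exact: nbhs_infty_ger.
Unshelve. all: by end_near. Qed.

Lemma cvg_expRN_invSS : expR (- n.+2%:R^-1) @[n --> \oo] --> (1 : R).
Proof.
rewrite -[X in _ --> X](expR0 R) -[X in expR X]oppr0.
have ce : {for (0 : R), continuous (fun t : R => expR (- t))}.
  apply: (@continuous_comp _ _ _ (fun t => - t) expR); last exact: continuous_expR.
  exact: opp_continuous.
exact: cvg_comp cvg_invSS ce.
Qed.

Lemma gamma_prim_cvg0 x : 0 < x -> gamma_prim x n.+2%:R^-1 @[n --> \oo] --> (0 : R).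
Proof.
move=> x0; rewrite -[X in _ --> X](mul0r (1 : R)).
apply: cvgM; last exact: cvg_expRN_invSS.
have /cvg_at_rightP/(_ (fun n => n.+2%:R^-1))h := powR_cvg0 x0.
by apply: h; split; [move=> n; rewrite invr_gt0 ltr0n|exact: cvg_invSS].
Qed.

Lemma gamma_prim_cvgy x : gamma_prim x n.+2%:R @[n --> \oo] --> (0 : R).
Proof.
have [N xN] : exists N : nat, x <= N%:R.
  by exists (Num.truncn x).+1; apply/ltW/truncnS_gt.
apply: (@squeeze_cvgr _ _ _ _ (fun=> 0) (fun n => N.+1`!%:R * n.+2%:R^-1)).
- near=> n; rewrite mulr_ge0 ?powR_ge0 ?expR_ge0//=.
  have n0 : 0 < n.+2%:R :> R by rewrite ltr0n.
  (* With t = n+2 and N >= x, t^x <= t^N while e^t >= t^(N+1)/(N+1)!; hence the bound (N+1)!/t. *)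
  rewrite /gamma_prim expRN ler_pdivrMr ?expR_gt0//.
  apply: (@le_trans _ _ (n.+2%:R ^+ N)).
    by rewrite -powR_mulrn ?ler0n// ler_powR// ler1n.
  have /(ler_wpM2l (_ : 0 <= N.+1`!%:R / n.+2%:R)) := @expR_ge1Dxn R n.+2%:R N (ltW n0).
  move=> /(_ (divr_ge0 (ler0n _ _) (ltW n0))); apply: le_trans.
  rewrite mulrDr exprS.
  have f0 : N.+1`!%:R != 0 :> R by rewrite pnatr_eq0 -lt0n fact_gt0.
  rewrite [X in _ + X](_ : _ = n.+2%:R ^+ N); last first.
    by field; rewrite f0 lt0r_neq0.
  by rewrite lerDr mulr1 divr_ge0// ltW.
- exact: cvg_cst.
- rewrite -[X in _ --> X](mulr0 (N.+1`!%:R)); apply: cvgM; first exact: cvg_cst.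
  exact: cvg_invSS.
Unshelve. all: by end_near. Qed.

Definition egamma x : \bar R := (\int[mu]_(t in `]0%R, +oo[) (gamma_kernel x t)%:E)%E.

Lemma integral_exhaustionE x n :
  (\int[mu]_(t in exhaustion n) (gamma_kernel x t)%:E)%E =
  (\int[mu]_(t in exhaustion n) gamma_kernel x t)%:E.
Proof.
rewrite /Rintegral fineK//; apply: integrable_fin_num; first exact: measurable_itv.
apply: (@integrable_exhaustion (gamma_kernel x)); exact: continuous_gamma_kernel.
Qed.

(* In \bar R, so that the functional equation can be used to prove finiteness. *)
Lemma egammaS x : 0 < x -> (egamma (x + 1) = x%:E * egamma x)%E.
Proof.
move=> x0.
have cv y := @cvg_integral_exhaustion _ (fun t _ => gamma_kernel_ge0 y t)
  (@continuous_gamma_kernel y).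
have l1 : (x%:E * \int[mu]_(t in exhaustion n) (gamma_kernel x t)%:E)%E @[n --> \oo]
    --> (x%:E * egamma x)%E.
  by apply: cvgeZl => //; exact: cv.
have l2 : ((\int[mu]_(t in exhaustion n) (gamma_kernel (x + 1) t)%:E) +
    (gamma_prim x n.+2%:R - gamma_prim x n.+2%:R^-1)%:E)%E @[n --> \oo]
    --> (egamma (x + 1) + 0)%E.
  apply: cvgeD; [exact: fin_num_adde_defl|exact: cv|].
  apply: cvg_EFin; first by near=> n.
  rewrite -[X in _ --> X](subr0 (0:R)); apply: cvgB.
    exact: gamma_prim_cvgy.
  exact: gamma_prim_cvg0.
rewrite -[LHS]adde0; apply: (cvg_unique _ l2); first exact: ereal_hausdorff.
apply: cvg_trans l1; apply: near_eq_cvg; near=> n.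
by rewrite !integral_exhaustionE -EFinM -EFinD -Rintegral_gamma_kernelS.
Unshelve. all: by end_near. Qed.

(** The case x = 0 of the integration by parts: the left side vanishes and the boundary terms give
    exp(-1/(n+2)) - exp(-(n+2)), which tends to 1. *)
Lemma egamma1 : egamma 1 = 1%E.
Proof.
have := @cvg_integral_exhaustion _ (fun t _ => gamma_kernel_ge0 1 t)
  (@continuous_gamma_kernel 1).
rewrite -/(egamma 1) => l1.
apply: (cvg_unique _ l1); first exact: ereal_hausdorff.
apply: cvg_EFin; first by near=> n; rewrite integral_exhaustionE.
suff h : (gamma_prim 0 n.+2%:R^-1 - gamma_prim 0 n.+2%:R) @[n --> \oo] --> (1 : R).
  apply: cvg_trans h; apply: near_eq_cvg; near=> n.
  rewrite /= integral_exhaustionE/=.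
  have := @Rintegral_gamma_kernelS 0 n; rewrite mul0r add0r => /esym/eqP.
  by rewrite addr_eq0 opprB => /eqP <-.
rewrite -[X in _ --> X](subr0 (1 : R)); apply: cvgB; last exact: gamma_prim_cvgy.
under eq_fun do rewrite /gamma_prim powRr0 mul1r.
exact: cvg_expRN_invSS.
Unshelve. all: by end_near. Qed.

(** * Growth bound, finiteness and positivity *)

Lemma powR_tangent (s t y : R) : 0 < s -> 0 < t -> 0 <= y <= 1 ->
  t `^ y <= s `^ y * ((1 - y) + y * (t / s)).
Proof.
move=> s0 t0 /andP[y0 y1].
have u0 : 0 < t / s by rewrite divr_gt0.
rewrite -{1}(divfK (lt0r_neq0 s0) t) powRM ?(ltW u0) ?(ltW s0)//.
rewrite [X in X <= _]mulrC ler_wpM2l ?powR_ge0//.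
set u := t / s in u0 *.
have A0 : 0 < 1 - y + y * u.
  have [->|yn0] := eqVneq y 0; first by lra.
  by rewrite ltr_wpDl ?subr_ge0// mulr_gt0// lt_neqAle eq_sym yn0.
rewrite {1}/powR (gt_eqF u0) -[leRHS]lnK ?posrE// ler_expR.
(* Concavity of ln between u = t/s and 1, with weights y and 1 - y. *)
have := @concave_ln R (Itv01 y0 y1) u 1 u0 ltr01.
by rewrite !convRE/= /unstable.onem ln1 mulr0 addr0 mulr1 [y * u + _]addrC.
Qed.

(** Integrating [powR_tangent] against the kernel at s gives a combination of [egamma s] and
    [egamma (s + 1) = s * egamma s]. As the tangent is taken at t = s, the coefficients add up to
    s^y. *)
Lemma egamma_le (s y : R) : 0 < s -> 0 <= y <= 1 ->
  (egamma (s + y) <= (s `^ y)%:E * egamma s)%E.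
Proof.
move=> s0 y01; have /andP[y0 y1] := y01.
have mE x : measurable_fun (`]0, +oo[%classic : set R) (EFin \o gamma_kernel x).
  by apply/measurable_EFinP; exact: measurable_gamma_kernel.
have k0 x t : (0 <= (gamma_kernel x t)%:E)%E by rewrite lee_fin gamma_kernel_ge0.
pose a := s `^ y * (1 - y); pose b := s `^ y * y / s.
have a0 : 0 <= a by rewrite mulr_ge0 ?powR_ge0// subr_ge0.
have b0 : 0 <= b by rewrite divr_ge0 ?mulr_ge0 ?powR_ge0// ltW.
have mZ (c x : R) : measurable_fun (`]0, +oo[%classic : set R)
    (fun t => c%:E * (gamma_kernel x t)%:E)%E.
  by apply: emeasurable_funM => //; exact: mE.
apply: (@le_trans _ _ (\int[mu]_(t in `]0%R, +oo[)
  (a%:E * (gamma_kernel s t)%:E + b%:E * (gamma_kernel (s + 1) t)%:E))%E).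
  apply: ge0_le_integral => //.
  - exact: mE.
  - by apply: emeasurable_funD; exact: mZ.
  - move=> t; rewrite /= in_itv/= andbT => t0.
    rewrite -!EFinM -EFinD lee_fin /gamma_kernel addrK.
    have -> : s + y - 1 = s - 1 + y by ring.
    rewrite [t `^ (s - 1 + y)]powRD; last by rewrite (gt_eqF t0) implybT.
    have -> : t `^ s = t `^ (s - 1) * t.
      by rewrite mulrC mulr_powRB1// ltW.
    have h := powR_tangent s0 t0 y01.
    have c0 : 0 <= t `^ (s - 1) * expR (- t) by rewrite mulr_ge0 ?powR_ge0 ?expR_ge0.
    rewrite [leLHS](_ : _ = t `^ (s - 1) * expR (- t) * t `^ y); last by ring.
    apply: le_trans (ler_wpM2l c0 h) _; rewrite le_eqVlt; apply/orP; left.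
    by apply/eqP; rewrite /a /b; field; rewrite gt_eqF.
rewrite ge0_integralD//=; last 4 first.
- by move=> t _; rewrite mule_ge0// lee_fin.
- exact: mZ.
- by move=> t _; rewrite mule_ge0// lee_fin.
- exact: mZ.
rewrite !ge0_integralZl_EFin//; [|exact: mE..].
rewrite -!/(egamma _) egammaS// muleA -EFinM -ge0_muleDl ?lee_fin//; last first.
  by rewrite mulr_ge0// ltW.
rewrite -EFinD (_ : a + b * s = s `^ y)//.
by rewrite /a /b; field; rewrite gt_eqF.
Qed.

(** For x <= 1, [egamma (1 + x) <= egamma 1 = 1], and the functional equation carries finiteness
    from x + 1 down to x; larger arguments follow by induction upwards. *)
Lemma egamma_fin x : 0 < x -> egamma x \is a fin_num.
Proof.
have egamma_ge0 z : (0 <= egamma z)%E.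
  by apply: integral_ge0 => t _; rewrite lee_fin gamma_kernel_ge0.
have down z : 0 < z -> (egamma (z + 1) \is a fin_num) = (egamma z \is a fin_num).
  move=> z0; rewrite egammaS//; have := egamma_ge0 z.
  by case: (egamma z) => // _; rewrite gt0_muley ?lte_fin.
move=> x0; have [n] : exists n : nat, x <= n.+1%:R.
  by exists (Num.truncn x); apply/ltW/truncnS_gt.
elim: n x x0 => [x x0 x1|n ih x x0 xn].
  rewrite -down//; have := @egamma_le 1 x ltr01; rewrite (ltW x0) x1 => /(_ isT).
  rewrite powR1 mul1e egamma1 addrC => le1.
  by rewrite ge0_fin_numE// (le_lt_trans le1)// ltry.
have [x1|x1] := leP x 1; first by apply: ih => //; rewrite (le_trans x1)// ler1n.
rewrite -(subrK 1 x) down ?subr_gt0//; apply: ih; first by rewrite subr_gt0.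
by rewrite lerBlDr natr1.
Qed.

Lemma egammaE x : 0 < x -> egamma x = (Gamma x)%:E.
Proof. by move=> x0; rewrite /Gamma /Rintegral fineK// egamma_fin. Qed.

Lemma Gamma1 : Gamma (1 : R) = 1.
Proof. by apply/EFin_inj; rewrite -egammaE// egamma1. Qed.

Lemma GammaS x : 0 < x -> Gamma (x + 1) = x * Gamma x.
Proof.
move=> x0; apply/EFin_inj.
by rewrite -egammaE ?addr_gt0// egammaS// egammaE// EFinM.
Qed.

Lemma Gamma_le (s y : R) : 0 < s -> 0 <= y <= 1 -> Gamma (s + y) <= s `^ y * Gamma s.
Proof.
move=> s0 y01; rewrite -lee_fin EFinM -!egammaE//; first exact: egamma_le.
by case/andP: y01 => y0 _; rewrite ltr_pwDl.
Qed.

Lemma Gamma_gt0 x : 0 < x -> 0 < Gamma x.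
Proof.
move=> x0; have [n] : exists n : nat, x <= n.+1%:R.
  by exists (Num.truncn x); apply/ltW/truncnS_gt.
elim: n x x0 => [x x0 x1|n ih x x0 xn].
  (* For x <= 1, 1 = Gamma (x + (1 - x)) <= x^(1-x) Gamma x forces positivity. *)
  have := @Gamma_le x (1 - x) x0; rewrite subrKC Gamma1.
  rewrite subr_ge0 x1 lerBlDr lerDl (ltW x0) => /(_ isT) /(lt_le_trans ltr01).
  by rewrite pmulr_rgt0// powR_gt0.
have [x1|x1] := leP x 1; first by apply: ih => //; rewrite (le_trans x1)// ler1n.
rewrite -(subrK 1 x) GammaS ?subr_gt0// mulr_gt0 ?subr_gt0//.
apply: ih; first by rewrite subr_gt0.
by rewrite lerBlDr natr1.
Qed.

Lemma Gamma_nat n : Gamma n.+1%:R = n`!%:R :> R.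
Proof.
elim: n => [|n ih]; first by rewrite Gamma1 fact0.
by rewrite -natr1 GammaS ?ltr0n// ih factS natrM.
Qed.

Lemma lnGammaS x : 0 < x -> ln (Gamma (x + 1)) = ln (Gamma x) + ln x.
Proof. by move=> x0; rewrite GammaS// lnM ?posrE ?Gamma_gt0// addrC. Qed.

Lemma lnGamma_addn x n : 0 < x ->
  ln (Gamma (x + n%:R)) = ln (Gamma x) + \sum_(j < n) ln (x + j%:R).
Proof.
move=> x0; elim: n => [|n ih]; first by rewrite big_ord0 !addr0.
by rewrite big_ord_recr/= addrA -ih -natr1 addrA lnGammaS// ltr_wpDr.
Qed.

End GammaIntegral.

(** * Gauss' product and the digamma series *)

(* Otherwise unification and [ring] unfold the integral. *)
Opaque Gamma.

Section GaussProduct.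
Variable R : realType.
Implicit Types (x a h : R) (n : nat).

Lemma ln_add_ge a x : 0 < a -> 0 <= x -> x / (a + x) <= ln (a + x) - ln a.
Proof.
move=> a0 x0; have ax0 : 0 < a + x by rewrite ltr_wpDr.
have lnr : ln (a / (a + x)) <= - (x / (a + x)).
  have -> : a / (a + x) = 1 + - (x / (a + x)) by field; rewrite gt_eqF.
  by rewrite le_ln1Dx// ltrN2 ltr_pdivrMr// mul1r ltrDr.
by move: lnr; rewrite ln_div ?posrE//; lra.
Qed.

Lemma ln_add_le a x : 0 < a -> 0 <= x -> ln (a + x) - ln a <= x / a.
Proof.
move=> a0 x0; have ax0 : 0 < a + x by rewrite ltr_wpDr.
rewrite -ln_div ?posrE//.
have -> : (a + x) / a = 1 + x / a by field; rewrite gt_eqF.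
by rewrite le_ln1Dx// (lt_le_trans (ltrN10 _))// divr_ge0// ltW.
Qed.

Lemma ln_add_cvg0 x : 0 <= x -> (ln (n.+1%:R + x) - ln n.+1%:R) @[n --> \oo] --> (0 : R).
Proof.
move=> x0; apply: (@squeeze_cvgr _ _ _ _ (fun=> 0) (fun n => x * n.+1%:R^-1)).
- near=> n; have n0 : 0 < n.+1%:R :> R by rewrite ltr0n.
  rewrite ln_add_le// andbT; apply: le_trans (ln_add_ge n0 x0).
  by rewrite divr_ge0// addr_ge0// ltW.
- exact: cvg_cst.
- rewrite -[X in _ --> X](mulr0 x); apply: cvgM; first exact: cvg_cst.
  exact: cvg_harmonic.
Unshelve. all: by end_near. Qed.

(** Logarithm of Gauss' partial product n! (n+1)^x / (x (x+1) ... (x+n)), with (n+1)^x for the usual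
    n^x; the limit is the same. *)
Definition gauss n x : R :=
  x * ln n.+1%:R + ln n`!%:R - \sum_(j < n.+1) ln (x + j%:R).

Lemma gaussS n x : 0 < x ->
  gauss n (x + 1) = gauss n x + ln x - (ln (n.+1%:R + x) - ln n.+1%:R).
Proof.
move=> x0; rewrite /gauss big_ord_recr/= [in RHS]big_ord_recl/=.
have -> : \sum_(i < n) ln (x + (bump 0 i)%:R) = \sum_(i < n) ln (x + 1 + i%:R).
  by apply: eq_bigr => i _; rewrite -addrA nat1r.
have -> : x + 1 + n%:R = n.+1%:R + x by rewrite -addrA nat1r addrC.
by rewrite addr0; ring.
Qed.

(** The difference from [ln (Gamma x)] compares Gamma (n+1+x) with (n+1)^x n!. It is squeezed by
    [Gamma_le] applied from n+1 to n+1+x and from n+1+x to n+2. *)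
Lemma gauss_cvg_le1 x : 0 < x <= 1 -> gauss n x @[n --> \oo] --> ln (Gamma x).
Proof.
move=> /andP[x0 x1].
have x01 : 0 <= x <= 1 by rewrite ltW.
have y01 : 0 <= 1 - x <= 1 by rewrite subr_ge0 x1 lerBlDr lerDl ltW.
have f0 n : 0 < n`!%:R :> R by rewrite ltr0n fact_gt0.
apply: (@squeeze_cvgr _ _ _ _ (fun=> ln (Gamma x))
  (fun n => ln (Gamma x) + (ln (n.+1%:R + x) - ln n.+1%:R))); last 2 first.
- exact: cvg_cst.
- rewrite -[X in _ --> X]addr0; apply: cvgD; first exact: cvg_cst.
  by apply: ln_add_cvg0; exact: ltW.
near=> n.
have n0 : 0 < n.+1%:R :> R by rewrite ltr0n.
have nx0 : 0 < n.+1%:R + x by rewrite addr_gt0.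
have G0 : 0 < Gamma (n.+1%:R + x) by exact: Gamma_gt0.
have e : gauss n x = ln (Gamma x) + (x * ln n.+1%:R + ln n`!%:R - ln (Gamma (n.+1%:R + x))).
  rewrite /gauss [n.+1%:R + x]addrC (lnGamma_addn n.+1 x0).
  by move: (ln (Gamma x)) (ln n.+1%:R) (ln n`!%:R) => L a b; ring.
rewrite e lerDl subr_ge0 lerD2l; apply/andP; split.
  have := Gamma_le n0 x01.
  rewrite Gamma_nat -ler_ln ?posrE ?mulr_gt0 ?powR_gt0//.
  by rewrite lnM ?posrE ?powR_gt0// ln_powR.
(* Here (n+1)! <= (n+1+x)^(1-x) Gamma (n+1+x), so the excess over [ln (Gamma x)] is at most (1-x)
   (ln (n+1+x) - ln (n+1)). *)
have := Gamma_le nx0 y01.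
rewrite -addrA subrKC natr1 Gamma_nat -ler_ln ?posrE ?mulr_gt0 ?powR_gt0//.
rewrite lnM ?posrE ?powR_gt0// ln_powR factS natrM lnM ?posrE//.
have : 0 <= ln (n.+1%:R + x) - ln n.+1%:R.
  by apply: le_trans (ln_add_ge n0 (ltW x0)); rewrite divr_ge0// ltW.
move=> h1 h2; have : 0 <= x * (ln (n.+1%:R + x) - ln n.+1%:R) by rewrite mulr_ge0// ltW.
clear e; move: h1 h2.
move: (ln (Gamma _)) (ln n`!%:R) (ln (n.+1%:R + x)) (ln n.+1%:R) => a b c d.
clear -x0 x1; lra.
Unshelve. all: by end_near. Qed.

Lemma gauss_cvg x : 0 < x -> gauss n x @[n --> \oo] --> ln (Gamma x).
Proof.
move=> x0; have [m] : exists m : nat, x <= m.+1%:R.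
  by exists (Num.truncn x); apply/ltW/truncnS_gt.
elim: m x x0 => [x x0 x1|m ih x x0 xm]; first by apply: gauss_cvg_le1; rewrite x0.
have [x1|x1] := leP x 1; first by apply: ih => //; rewrite (le_trans x1)// ler1n.
have y0 : 0 < x - 1 by rewrite subr_gt0.
have cy : gauss n (x - 1) @[n --> \oo] --> ln (Gamma (x - 1)).
  by apply: ih => //; rewrite lerBlDr natr1.
have e : ln (Gamma x) = ln (Gamma (x - 1)) + ln (x - 1) - 0.
  by have := lnGammaS y0; rewrite subrK => ->; rewrite subr0.
have -> : gauss ^~ x =
    fun n => gauss n (x - 1) + ln (x - 1) - (ln (n.+1%:R + (x - 1)) - ln n.+1%:R).
  by apply/funext => n; rewrite -gaussS// subrK.
rewrite e; apply: cvgB; last by apply: ln_add_cvg0; exact: ltW.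
by apply: cvgD; [exact: cy|exact: cvg_cst].
Qed.

(** * Digamma as the limit of the derivatives of [gauss n] *)

Definition digamma_seq n x : R := ln n.+1%:R - \sum_(j < n.+1) (x + j%:R)^-1.

(** Up to sign, replacing ln (n+1) by ln (n+1+x) gives a nondecreasing bounded sequence [a], by
    comparing 1/(x+j) with increments of ln; the replacement costs a term tending to 0. *)
Lemma digamma_seq_cvg x : 0 < x -> cvgn (digamma_seq ^~ x).
Proof.
move=> x0; pose a n := \sum_(j < n.+1) (x + j%:R)^-1 - ln (n.+1%:R + x).
have n0 n : 0 < n%:R + x by rewrite ltr_wpDl.
have ca : cvgn a.
  apply: nondecreasing_is_cvgn.
    apply/nondecreasing_seqP => n; rewrite /a [in leRHS]big_ord_recr/=.
    have := @ln_add_le (n.+1%:R + x) 1 (n0 _) ler01.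
    rewrite addrAC natr1 mul1r [x + _]addrC; lra.
  exists (x^-1 - ln x) => _ [n _ <-].
  have : \sum_(j < n.+1) (x + j%:R)^-1 <= x^-1 + ln (n%:R + x) - ln x.
    elim: n => [|n ih]; first by rewrite big_ord_recr big_ord0/= !add0r addr0 addrK.
    rewrite big_ord_recr/=; have := @ln_add_ge (n%:R + x) 1 (n0 _) ler01.
    rewrite addrAC natr1 mul1r [x + n.+1%:R]addrC; lra.
  have := @ln_add_ge (n%:R + x) 1 (n0 _) ler01.
  have : 0 <= 1 / (n%:R + x + 1) by rewrite divr_ge0// addr_ge0// ltW.
  rewrite addrAC natr1 /a; lra.
have -> : digamma_seq ^~ x = (fun n => - a n - (ln (n.+1%:R + x) - ln n.+1%:R)).
  by apply/funext => n; rewrite /digamma_seq /a; ring.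
apply: is_cvgB; first exact: is_cvgN.
by apply: cvgP; apply: ln_add_cvg0; exact: ltW.
Qed.

Definition digamma x : R := limn (digamma_seq ^~ x).

(** The bound does not depend on n, so it passes to the limit and yields the derivative of log
    Gamma. Up to sign, each j contributes ln (1+u) - u with u = h/(x+j). *)
Lemma gauss_quadratic n x h : 0 < x -> `|h| <= x / 2 ->
  `|gauss n (x + h) - gauss n x - h * digamma_seq n x| <= 2 * h ^+ 2 * ((x ^+ 2)^-1 + x^-1).
Proof.
move=> x0 hx.
have [h1 h2] : - (x / 2) <= h /\ h <= x / 2 by apply/andP; rewrite -ler_norml.
have e : gauss n (x + h) - gauss n x - h * digamma_seq n x =
    - \sum_(j < n.+1) (ln (x + h + j%:R) - ln (x + j%:R) - h * (x + j%:R)^-1).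
  by rewrite /gauss /digamma_seq !sumrB -mulr_sumr; ring.
rewrite e normrN; apply: (le_trans (ler_norm_sum _ _ _)).
apply: (@le_trans _ _ (\sum_(j < n.+1) 2 * h ^+ 2 * ((x + j%:R) ^+ 2)^-1)).
  apply: ler_sum => j _; set y := x + j%:R.
  have xy : x <= y by rewrite lerDl.
  have y0 : 0 < y by exact: lt_le_trans xy.
  have yh0 : 0 < y + h by lra.
  rewrite [x + h + _]addrAC -/y -ln_div ?posrE//.
  set u := h / y.
  (* From |h| <= x/2: then 1 + u >= 1/2, and u^2/(1+u) <= 2 u^2. *)
  have u1 : - (1 / 2) <= u by rewrite /u ler_pdivlMr//; lra.
  have u0 : 0 < 1 + u by lra.
  have -> : (y + h) / y = 1 + u by rewrite /u; field; rewrite gt_eqF.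
  have -> : 2 * h ^+ 2 * (y ^+ 2)^-1 = 2 * u ^+ 2 by rewrite /u; field; rewrite gt_eqF.
  have ub : ln (1 + u) <= u by apply: le_ln1Dx; lra.
  have lb : u / (1 + u) <= ln (1 + u).
    have /le_ln1Dx : -1 < - (u / (1 + u)) by rewrite ltrN2 ltr_pdivrMr// mul1r; lra.
    have -> : 1 - u / (1 + u) = (1 + u)^-1 by field; rewrite gt_eqF.
    by rewrite lnV ?posrE// lerN2.
  have : - (2 * u ^+ 2) <= u / (1 + u) - u.
    have -> : u / (1 + u) - u = - (u ^+ 2 / (1 + u)) by field; rewrite gt_eqF.
    rewrite lerN2 ler_pdivrMr//.
    have := sqr_ge0 u; nra.
  have := sqr_ge0 u.
  by rewrite ler_norml; lra.
rewrite -mulr_sumr; apply: ler_wpM2l; first by rewrite mulr_ge0 ?sqr_ge0.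
(* The subtracted 1/(x+n) lets the induction telescope, through 1/(y+1)^2 <= 1/y - 1/(y+1). *)
have : \sum_(j < n.+1) ((x + j%:R) ^+ 2)^-1 <= (x ^+ 2)^-1 + x^-1 - (x + n%:R)^-1.
  elim: n {e} => [|n ih].
    by rewrite big_ord_recr big_ord0/= add0r addr0 addrK.
  rewrite big_ord_recr/=; apply: (le_trans (lerD ih (lexx _))).
  have y0 : 0 < x + n%:R by rewrite ltr_wpDr.
  rewrite -natr1 addrA; set y := x + n%:R in y0 *.
  have y10 : 0 < y + 1 by lra.
  have : ((y + 1) ^+ 2)^-1 <= y^-1 - (y + 1)^-1.
    rewrite -subr_ge0.
    have -> : y^-1 - (y + 1)^-1 - ((y + 1) ^+ 2)^-1 = (y * (y + 1) ^+ 2)^-1.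
      by field; rewrite !gt_eqF.
    by rewrite invr_ge0 mulr_ge0 ?sqr_ge0// ltW.
  by lra.
have : 0 <= (x + n%:R)^-1 by rewrite invr_ge0 addr_ge0// ltW.
by move=> i0 /le_trans; apply; rewrite lerBlDr lerDl.
Qed.

Lemma lnGamma_quadratic x h : 0 < x -> `|h| <= x / 2 ->
  `|ln (Gamma (x + h)) - ln (Gamma x) - h * digamma x| <= 2 * h ^+ 2 * ((x ^+ 2)^-1 + x^-1).
Proof.
move=> x0 hx.
have [h1 h2] : - (x / 2) <= h /\ h <= x / 2 by apply/andP; rewrite -ler_norml.
have c : `|gauss n (x + h) - gauss n x - h * digamma_seq n x| @[n --> \oo] -->
    `|ln (Gamma (x + h)) - ln (Gamma x) - h * digamma x|.
  apply: cvg_norm; apply: cvgB.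
    by apply: cvgB; apply: gauss_cvg => //; lra.
  by apply: cvgM; [exact: cvg_cst|exact: digamma_seq_cvg].
by apply: (cvgr_to_le c); near=> n; exact: gauss_quadratic.
Unshelve. all: by end_near. Qed.

Lemma is_derive_lnGamma x : 0 < x ->
  is_derive x 1 (fun z => ln (Gamma z)) (digamma x).
Proof.
move=> x0; set f := fun z => ln (Gamma z).
suff c : h^-1 *: ((f \o shift x) (h *: (1 : R)) - f x) @[h --> 0^'] --> digamma x.
  by split; [exact: cvgP c|exact: cvg_lim c].
pose K := 2 * ((x ^+ 2)^-1 + x^-1).
have K0 : 0 < K by rewrite mulr_gt0// addr_gt0// invr_gt0// exprn_gt0.
apply/cvgrPdistC_le => e e0; near=> h.
have h0 : h != 0 by near: h; exact: nbhs_dnbhs_neq.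
have hx : `|h| <= x / 2.
  near: h; apply: dnbhs0_le; lra.
have he : `|h| <= e / K.
  by near: h; apply: dnbhs0_le; rewrite divr_gt0.
rewrite /= /GRing.scale/= mulr1 [h + x]addrC.
have -> : h^-1 * (f (x + h) - f x) - digamma x = h^-1 * (f (x + h) - f x - h * digamma x).
  by move: (f _) (f _) (digamma x) => a b c; field.
rewrite normrM normfV mulrC ler_pdivrMr ?normr_gt0//.
apply: (le_trans (lnGamma_quadratic x0 hx)).
rewrite [leLHS](_ : _ = K * `|h| * `|h|); last first.
  by rewrite -(real_normK (num_real h)) /K; ring.
by rewrite ler_wpM2r// mulrC -ler_pdivlMr.
Unshelve. all: by end_near. Qed.

(** [Psi] is built on the derivative of Gamma itself, so the chain rule is applied to exp (ln
    Gamma), which agrees with Gamma in a neighbourhood of x, where Gamma is positive. *)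
Lemma PsiE x : 0 < x -> Psi x = digamma x.
Proof.
move=> x0; have G0 := Gamma_gt0 x0.
have d : is_derive x 1 (@Gamma R) (Gamma x * digamma x).
  have h := @is_derive1_comp R expR (fun z => ln (Gamma z)) x _ _
    (is_derive_expR (ln (Gamma x))) (is_derive_lnGamma x0).
  rewrite lnK ?posrE// in h.
  apply: near_eq_is_derive h; near=> z; rewrite /= lnK// posrE; apply: Gamma_gt0.
  by near: z; exact: lt_nbhsr.
by rewrite /Psi derive1E derive_val mulrC mulKf// gt_eqF.
Unshelve. all: by end_near. Qed.

Lemma digamma_seq_cvgPsi x : 0 < x -> digamma_seq n x @[n --> \oo] --> Psi x.
Proof. by move=> x0; rewrite PsiE//; exact: digamma_seq_cvg. Qed.

(** The sequence is the one defining [euler_gamma], shifted by one; its convergence shows that the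
    [limn] there is a genuine limit. *)
Lemma euler_gamma_cvg : - digamma_seq n 1 @[n --> \oo] --> euler_gamma R.
Proof.
pose u := fun n : nat => \sum_(1 <= k < n.+1) (k%:R : R)^-1 - ln (n%:R : R).
have uE : [sequence u n.+1]_n = (fun n => - digamma_seq n 1).
  apply/funext => n; rewrite /u /digamma_seq/= opprB; congr (_ - _).
  rewrite big_add1/= big_mkord; apply: eq_bigr => i _; by rewrite nat1r.
have cu : u n @[n --> \oo] --> - digamma 1.
  by rewrite -cvg_shiftS uE; apply: cvgN; exact: digamma_seq_cvg.
rewrite /euler_gamma (cvg_lim _ cu)//.
by apply: cvgN; exact: digamma_seq_cvg.
Qed.

End GaussProduct.

(** * Counting blocks *)

Section BlockCount.
Local Open Scope nat_scope.
Implicit Types (w s : seq bool) (m n : nat).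

Lemma occurrences_cons w b s : occurrences w (b :: s) = prefix w (b :: s) + occurrences w s.
Proof. by rewrite /occurrences/= (iotaDl 1 0) count_map. Qed.

Lemma suffix_consr w b s : suffix w (b :: s) = (w == b :: s) || suffix w s.
Proof.
apply/idP/orP => [/suffixP[[|c t] /=]|[/eqP->|/suffixP[t ->]]].
- by move=> <-; left.
- by move=> [_ ->]; right; exact: suffix_suffix.
- exact: suffix_refl.
- by rewrite -cat_cons; exact: suffix_suffix.
Qed.

(** The appended digit can only complete the occurrence ending there. Since starting positions are
    counted, the induction runs from the front. *)
Lemma occurrences_rcons w s b : w != [::] ->
  occurrences w (rcons s b) = occurrences w s + suffix w (rcons s b).
Proof.
move=> w0; elim: s => [|a s ih].
  rewrite /= occurrences_cons suffix_consr addnC; congr addn.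
  have -> : suffix w [::] = false by case: w w0 => // c w _; rewrite suffixs0.
  rewrite orbF; case: w w0 => // c [|d w] _.
rewrite rcons_cons !occurrences_cons ih suffix_consr.
have -> : prefix w (a :: rcons s b) = prefix w (a :: s) || (w == a :: rcons s b).
  rewrite -rcons_cons; apply/idP/orP => [/prefixP[t]|[/prefixP[t ->]|/eqP->]].
  - elim/last_ind: t => [|t c _]; first by rewrite cats0 => ->; right.
    by rewrite -rcons_cat => /rcons_inj[-> _]; left; exact: prefix_prefix.
  - by rewrite rcons_cat; exact: prefix_prefix.
  - exact: prefix_refl.
(* By length, an occurrence filling the whole word is neither a prefix of [a :: s] nor a suffix of
   [rcons s b], so nothing is counted twice. *)
have h1 : ~~ (prefix w (a :: s) && (w == a :: rcons s b)).
  apply/negP => /andP[/prefixP[t /(congr1 size) e] /eqP ew]; move: e; rewrite ew.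
  by rewrite size_cat /= size_rcons; lia.
have h2 : ~~ (suffix w (rcons s b) && (w == a :: rcons s b)).
  apply/negP => /andP[/suffixP[t /(congr1 size) e] /eqP ew]; move: e; rewrite ew.
  by rewrite size_cat /= size_rcons; lia.
by move: h1 h2; case: (prefix w _); case: (w == _); case: (suffix w _) => //= _ _; lia.
Qed.

Lemma v2_rcons s b : v2 (rcons s b) = 2 * v2 s + b.
Proof.
rewrite /v2 size_rcons big_ord_recr/= nth_rcons ltnn eqxx subnn muln1.
congr addn; rewrite big_distrr/=; apply: eq_bigr => i _.
by rewrite nth_rcons ltn_ord subSn// expnS mulnCA.
Qed.

Lemma v2_lt s : v2 s < 2 ^ size s.
Proof.
elim/last_ind: s => [|s b ih]; first by rewrite /v2 big_ord0.
by rewrite v2_rcons size_rcons expnS; case: b; lia.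
Qed.

Lemma suffix_v2 w s : size w <= size s ->
  suffix w s = (v2 s %% 2 ^ size w == v2 w).
Proof.
elim/last_ind: w s => [|w b ih] s.
  by rewrite suffix0s expn0 modn1 /v2 big_ord0.
elim/last_ind: s => [|s c _]; rewrite !size_rcons// ltnS => ws.
rewrite suffix_rcons ih// !v2_rcons.
have -> : (2 * v2 s + c) %% 2 ^ (size w).+1 = 2 * (v2 s %% 2 ^ size w) + c.
  rewrite {1}(divn_eq (v2 s) (2 ^ size w)) mulnDr -addnA expnS mulnCA modnMDl modn_small//.
  have : v2 s %% 2 ^ size w < 2 ^ size w by rewrite ltn_mod expn_gt0.
  by case: c; lia.
by case: b; case: c => /=; lia.
Qed.

(* The expansion of 0 is taken to be empty, so that appending a digit is
   uniform in n. *)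
Definition digits n := if n == 0 then [::] else binary_expansion n.

Lemma digits_rcons n : 0 < n -> digits n = rcons (digits n./2) (odd n).
Proof.
rewrite /digits; case: n => [//|[//|n]] _.
have mkseq_cons (f : nat -> bool) k : mkseq f k.+1 = f 0 :: mkseq (f \o succn) k.
  by rewrite /mkseq/= (iotaDl 1 0) -map_comp.
rewrite /binary_expansion trunc_log2S// [in LHS]mkseq_cons rev_cons expn0 divn1.
congr (rcons (rev _) _); apply: eq_map => i /=.
by rewrite expnS divnMA divn2.
Qed.

Lemma v2_digits n : v2 (digits n) = n.
Proof.
elim/ltn_ind: n => -[|n] ih; first by rewrite /v2 big_ord0.
rewrite digits_rcons// v2_rcons ih; first by lia.
by lia.
Qed.

Definition leading_zeros w :=
  if ~~ head true w && (v2 w != 0) then nseq (size w) false else [::].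

(** Agrees with [block_count] for n > 0 but is 0 at n = 0, where [binary_expansion] would give a
    digit 0. The recursion on [n./2] needs this initial value. *)
Definition count_digits w n := occurrences w (leading_zeros w ++ digits n).

Lemma block_countE w n : 0 < n -> block_count w n = count_digits w n.
Proof.
rewrite /block_count /count_digits /leading_zeros /digits; case: n => // n _.
by case: ifP.
Qed.

Lemma occurrences_nseq0 w k : v2 w != 0 -> occurrences w (nseq k false) = 0.
Proof.
move=> w0; elim: k => [//|k ih]; rewrite (occurrences_cons _ _ (nseq k false)) ih addn0.
apply/eqP; rewrite eqb0; apply: contra w0 => /prefixP[t] e.
have := @take_size_cat _ (size w) w t erefl; rewrite -e => <-.
by rewrite -[false :: _]/(nseq k.+1 false) take_nseq ?v2_nseq0//; have := congr1 size e;
  rewrite size_cat /= size_nseq; lia.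
Qed.

Lemma count_digits0 w : count_digits w 0 = 0.
Proof.
rewrite /count_digits /leading_zeros /digits eqxx cats0; case: ifP => // /andP[_ w0].
exact: occurrences_nseq0.
Qed.

Lemma v2_cat_nseq0 k s : v2 (nseq k false ++ s) = v2 s.
Proof.
elim/last_ind: s => [|s b ih]; first by rewrite cats0 v2_nseq0 /v2 big_ord0.
by rewrite -rcons_cat !v2_rcons ih.
Qed.

Lemma v2_head w : head false w -> 2 ^ (size w).-1 <= v2 w.
Proof. case: w => // -[] // w _; rewrite /v2/= big_ord_recl/=; by rewrite subn1 mul1n leq_addr. Qed.

Lemma suffix_digits w n : 0 < n ->
  suffix w (leading_zeros w ++ digits n) = (n %% 2 ^ size w == v2 w).
Proof.
move=> n0.
have vE : v2 (leading_zeros w ++ digits n) = n.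
  by rewrite /leading_zeros; case: ifP => _; rewrite ?v2_cat_nseq0 v2_digits.
have [ws|sw] := leqP (size w) (size (leading_zeros w ++ digits n)).
  by rewrite suffix_v2// vE.
(* The string is shorter than w, so w was not padded. The congruence fails too: it would give n =
   [v2 w] > 0, so w would begin with 1 and [v2 w] would be at least 2^(|w|-1) > n. *)
have n_lt : n < 2 ^ (size w).-1.
  rewrite -[n in n < _]vE (leq_trans (v2_lt _))// leq_exp2l//; lia.
have -> : suffix w (leading_zeros w ++ digits n) = false.
  by apply/negP => /size_suffix; rewrite leqNgt sw.
have n_lt' : n < 2 ^ size w.
  by rewrite (leq_trans n_lt)// leq_exp2l//; lia.
rewrite modn_small//; apply/esym/eqP => nw.
move: sw; rewrite /leading_zeros; case: ifP => [_|]; first by rewrite size_cat size_nseq; lia.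
rewrite -nw -lt0n n0 andbT => /negbFE hw _.
have : 2 ^ (size w).-1 <= v2 w.
  by apply: v2_head; case: w hw nw {vE n_lt n_lt'} => //; rewrite /v2 big_ord0; lia.
by lia.
Qed.

Lemma count_digits_half w n : w != [::] -> 0 < n ->
  count_digits w n = count_digits w n./2 + (n %% 2 ^ size w == v2 w).
Proof.
move=> w0 n0; rewrite -suffix_digits// /count_digits digits_rcons//.
by rewrite -rcons_cat occurrences_rcons.
Qed.

(* The growth is logarithmic; any bound o(m) would do. *)
Lemma count_digits_sqr w n : w != [::] -> count_digits w n ^ 2 <= 5 * n.
Proof.
move=> w0; elim/ltn_ind: n => -[|n] ih; first by rewrite count_digits0.
rewrite count_digits_half//.
have := ih n.+1./2 ltac:(lia).
have := count_digits_half w0 (_ : 0 < n.+1).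
move: (count_digits w n.+1./2) => a.
have [h0|h0] := eqVneq n.+1./2 0.
  have -> : n = 0 by lia.
  by case: (_ == _); nia.
(* With h = [n.+1./2] >= 1, a^2 <= 5h implies (a+1)^2 <= 10h: directly if a <= 2, and since 2a+1 <=
   a^2 otherwise. The constant 4 would fail at a = 2, h = 1. *)
by case: (_ == _); nia.
Qed.

(** With v in 1..q, v is the least positive member of its class, also for the class of 0. K + (q -
    v) is a multiple of q exactly when K is in the class, so the quotient counts the members up to
    K. *)
Lemma sum_residue (V : nmodType) (F : nat -> V) q v K : 0 < v <= q ->
  (\sum_(1 <= m < K.+1 | (m == v %[mod q])) F m =
   \sum_(j < (K + (q - v)) %/ q) F (q * j + v)%N)%R.
Proof.
move=> /andP[v0 vq]; have q0 : 0 < q by lia.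
elim: K => [|K ih].
  by rewrite big_geq// add0n divn_small ?big_ord0//; lia.
rewrite big_mkcond big_nat_recr//= -big_mkcond/= ih addSn divnS//.
have -> : (q %| (K + (q - v)).+1) = (K.+1 == v %[mod q]).
  by rewrite -(eqn_modDr (q - v)) subnKC// modnn -addSn.
case: ifP => [h|_]; last by rewrite add0n addr0.
rewrite add1n big_ord_recr/=; congr (_ + F _)%R.
have /dvdnP[j e] : q %| (K + (q - v)).+1.
  by rewrite -addSn /dvdn -(modnn q) -[X in _ == X %[mod _]](subnKC vq) eqn_modDr.
have -> : (K + (q - v)) %/ q = j.-1.
  have := divnS (K + (q - v)) q0; rewrite e mulnK// dvdn_mull//; lia.
case: j e => [//|j]; rewrite mulSn [q * _]mulnC /=; lia.
Qed.

End BlockCount.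

(** * Summation *)

Section EtaSeries.
Variable R : realType.
Implicit Types (m n : nat).

(** Error of the trapezoidal rule for 1/t on [m, m+1]. *)
Definition eta m : R := (m%:R^-1 + m.+1%:R^-1) / 2 - (ln m.+1%:R - ln m%:R).

Lemma eta_split n : (0 < n)%N ->
  (2 * n%:R * (2 * n%:R + 1) * (2 * n%:R + 2))^-1 =
  eta n - (eta (2 * n) + eta (2 * n).+1).
Proof.
move=> n0; rewrite /eta.
have x0 : 0 < n%:R :> R by rewrite ltr0n.
have -> : (2 * n).+2%:R = 2 * n.+1%:R :> R by rewrite -natrM; congr (_%:R); lia.
have -> : (2 * n).+1%:R = 2 * n%:R + 1 :> R by rewrite -natrM natr1.
rewrite natrM !lnM ?posrE// -[n.+1%:R]natr1.
set x := n%:R in x0 *; move: (ln _) (ln _) (ln _) (ln _) => a b c d.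
by field; rewrite !gt_eqF//; lra.
Qed.

(** The increment of ln lies between 1/(m+1) and 1/m, so it differs from their mean by at most half
    their gap. *)
Lemma eta_bound m : (0 < m)%N -> `|eta m| <= (2 * m%:R ^+ 2)^-1.
Proof.
move=> m0; have x0 : 0 < m%:R :> R by rewrite ltr0n.
have := @ln_add_le R m%:R 1 x0 ler01; have := @ln_add_ge R m%:R 1 x0 ler01.
rewrite /eta -[m.+1%:R]natr1; set x := m%:R in x0 *.
move: (ln (x + 1) - ln x) => d; rewrite !div1r => h1 h2.
have : x^-1 - (x + 1)^-1 <= (x ^+ 2)^-1.
  rewrite -subr_ge0.
  have -> : (x ^+ 2)^-1 - (x^-1 - (x + 1)^-1) = (x ^+ 2 * (x + 1))^-1.
    by field; rewrite !gt_eqF//; lra.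
  by rewrite invr_ge0 mulr_ge0 ?sqr_ge0//; lra.
have -> : (2 * x ^+ 2)^-1 = (x ^+ 2)^-1 / 2 by field; rewrite gt_eqF.
move: (x^-1) ((x + 1)^-1) ((x ^+ 2)^-1) h1 h2 => a b c h1 h2 h3.
by rewrite ler_norml; lra.
Qed.

Lemma sum_etaE (q v n : nat) (x := v%:R / q%:R : R) (y := v.+1%:R / q%:R : R) :
  (0 < v)%N -> (0 < q)%N ->
  \sum_(j < n.+1) eta (q * j + v) =
  gauss n y - gauss n x - 1 / (2 * q%:R) * (digamma_seq n x + digamma_seq n y).
Proof.
move=> v0 q0.
have qR : 0 < q%:R :> R by rewrite ltr0n.
have x0 : 0 < x by rewrite divr_gt0 ?ltr0n.
have y0 : 0 < y by rewrite divr_gt0 ?ltr0n.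
have termE (j : nat) : eta (q * j + v) =
    1 / (2 * q%:R) * ((x + j%:R)^-1 + (y + j%:R)^-1) - (ln (y + j%:R) - ln (x + j%:R)).
  have xj : 0 < x + j%:R by rewrite ltr_wpDr.
  have yj : 0 < y + j%:R by rewrite ltr_wpDr.
  have ex : (q * j + v)%:R = q%:R * (x + j%:R) :> R.
    by rewrite natrD natrM /x; field; rewrite gt_eqF.
  have ey : (q * j + v).+1%:R = q%:R * (y + j%:R) :> R.
    by rewrite -addnS natrD natrM /y; field; rewrite gt_eqF.
  rewrite /eta ex ey !lnM ?posrE//.
  move: (ln _) (ln _) (ln _) => a b c; move: (x + _) (y + _) xj yj => s t s0 t0.
  by field; rewrite !gt_eqF.
under eq_bigr do rewrite termE.
rewrite sumrB -mulr_sumr big_split/= sumrB /gauss /digamma_seq.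
(* Since y - x = 1/q, the ln (n+1) terms of [gauss] and [digamma_seq] cancel. *)
have -> : y = x + 1 / q%:R by rewrite /y /x -natr1; field; rewrite gt_eqF.
move: (ln n.+1%:R) (ln n`!%:R) (\sum_(_ < _) _) (\sum_(_ < _) _) (\sum_(_ < _) _)
  (\sum_(_ < _) _) => a b c d e f.
by field; rewrite gt_eqF.
Qed.

Lemma sum_eta_cvg (q v : nat) : (0 < v)%N -> (0 < q)%N ->
  (fun n => \sum_(j < n) eta (q * j + v)) @ \oo -->
  ln (Gamma (v.+1%:R / q%:R : R)) - ln (Gamma (v%:R / q%:R : R))
  - 1 / (2 * q%:R) * (Psi (v%:R / q%:R : R) + Psi (v.+1%:R / q%:R : R)).
Proof.
move=> v0 q0; rewrite -cvg_shiftS.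
have x0 : 0 < v%:R / q%:R :> R by rewrite divr_gt0 ?ltr0n.
have y0 : 0 < v.+1%:R / q%:R :> R by rewrite divr_gt0 ?ltr0n.
under eq_fun do rewrite sum_etaE//.
apply: cvgB; first by apply: cvgB; exact: gauss_cvg.
apply: cvgM; first exact: cvg_cst.
by apply: cvgD; exact: digamma_seq_cvgPsi.
Qed.

(** As n runs through 1..M-1, 2n and 2n+1 run through 2..2M-1, and N n = N m - c m at either value
    m. The m = 1 term fits because N 0 = 0; what does not cancel is the boundary sum over [M,
    2M[. *)
Lemma partial_sumE (N c : nat -> nat) M :
  N 0%N = 0%N -> (forall m, (0 < m)%N -> N m = (N m./2 + c m)%N) -> (0 < M)%N ->
  \sum_(1 <= n < M) (N n)%:R / (2 * n%:R * (2 * n%:R + 1) * (2 * n%:R + 2)) =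
  \sum_(1 <= m < 2 * M) (c m)%:R * eta m - \sum_(M <= m < 2 * M) (N m)%:R * eta m.
Proof.
move=> N0 NE; case: M => // M _; elim: M => [|M ih].
  by rewrite muln1 big_geq// !big_nat1 NE//= N0 add0n subrr.
rewrite big_nat_recr//= ih.
have -> : (2 * M.+2 = (2 * M.+1).+2)%N by lia.
have split2 (F : nat -> R) a k : (a <= k)%N ->
    \sum_(a <= m < k.+2) F m = \sum_(a <= m < k) F m + F k + F k.+1.
  by move=> ak; rewrite !big_nat_recr//; lia.
rewrite !split2; [|lia..].
rewrite eta_split//.
have -> : N (2 * M.+1)%N = (N M.+1 + c (2 * M.+1)%N)%N.
  by rewrite NE//; congr (N _ + _)%N; lia.
have -> : N (2 * M.+1).+1 = (N M.+1 + c (2 * M.+1).+1)%N.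
  by rewrite NE//; congr (N _ + _)%N; lia.
rewrite (@big_ltn _ _ _ M.+1); last by lia.
rewrite !natrD; move: (eta _) (eta _) (eta _) => x y z.
move: (\sum_(_ <= _ < _) _) (\sum_(_ <= _ < _) _) => u t.
move: (_%:R) (_%:R) (_%:R) => a b d; ring.
Qed.

Lemma remainder_cvg0 (N : nat -> nat) : (forall m, N m ^ 2 <= 5 * m)%N ->
  \sum_(M.+1 <= m < 2 * M.+1) (N m)%:R * eta m @[M --> \oo] --> (0 : R).
Proof.
move=> NE; apply/norm_cvg0P.
apply: (@squeeze_cvgr _ _ _ _ (fun=> 0) (fun M => Num.sqrt (10 * M.+1%:R^-1))).
- near=> M; rewrite normr_ge0/=.
  have K0 : 0 < M.+1%:R :> R by rewrite ltr0n.
  apply: (le_trans (ler_norm_sum _ _ _)).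
  (* There are M+1 terms, with N m <= sqrt (10 (M+1)) because m < 2(M+1), and |eta m| <=
     1/(M+1)^2. *)
  have bound m : (M.+1 <= m < 2 * M.+1)%N ->
      `|(N m)%:R * eta m| <= Num.sqrt (10 * M.+1%:R^-1) / M.+1%:R.
    move=> /andP[m1 m2]; have m0 : (0 < m)%N by lia.
    have mR : M.+1%:R <= m%:R :> R by rewrite ler_nat.
    rewrite normrM ger0_norm//.
    apply: (@le_trans _ _ ((Num.sqrt (10 * M.+1%:R^-1) * M.+1%:R) * (M.+1%:R ^+ 2)^-1)).
      apply: ler_pM => //.
        rewrite -(@ler_pXn2r _ 2)// ?nnegrE ?mulr_ge0 ?sqrtr_ge0//.
        rewrite exprMn sqr_sqrtr; last by rewrite mulr_ge0// invr_ge0.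
        rewrite [leRHS](_ : _ = 10 * M.+1%:R); last by field; rewrite gt_eqF.
        by rewrite -natrX -natrM ler_nat; have := NE m; lia.
      apply: (le_trans (eta_bound m0)); rewrite lef_pV2 ?posrE ?mulr_gt0 ?exprn_gt0 ?ltr0n//.
      have : M.+1%:R ^+ 2 <= m%:R ^+ 2 :> R by rewrite ler_pXn2r// nnegrE.
      have := sqr_ge0 (m%:R : R); lra.
    by rewrite le_eqVlt; apply/orP; left; apply/eqP; field; rewrite gt_eqF.
  apply: (le_trans (ler_sum_nat bound)).
  rewrite sumr_const_nat -[_ *+ (_ - _)]mulr_natr.
  have -> : (2 * M.+1 - M.+1 = M.+1)%N by lia.
  by rewrite divfK// gt_eqF.
- exact: cvg_cst.
- rewrite -[X in _ --> X](sqrtr0 R) -[X in Num.sqrt X](mulr0 (10 : R)).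
  apply: continuous_cvg; first exact: sqrt_continuous.
  by apply: cvgM; [exact: cvg_cst|exact: cvg_harmonic].
Unshelve. all: by end_near. Qed.

(** Serves both cases of the theorem: v is v_2(w) when this is nonzero, and q otherwise. *)
Lemma block_series_cvg (N : nat -> nat) (q v : nat) (v0q : (0 < v <= q)%N) :
  N 0%N = 0%N -> (forall m, N m ^ 2 <= 5 * m)%N ->
  (forall m, (0 < m)%N -> N m = (N m./2 + (m == v %[mod q])%N)%N) ->
  (fun M : nat => \sum_(1 <= n < M) (N n)%:R /
      (2 * n%:R * (2 * n%:R + 1) * (2 * n%:R + 2))) @ \oo -->
  ln (Gamma (v.+1%:R / q%:R : R)) - ln (Gamma (v%:R / q%:R : R))
  - 1 / (2 * q%:R) * (Psi (v%:R / q%:R : R) + Psi (v.+1%:R / q%:R : R)).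
Proof.
move=> N0 N5 NE; have /andP[v0 vq] := v0q; have q0 : (0 < q)%N by lia.
set l := (X in _ --> X); rewrite -(subr0 l) -cvg_shiftS.
under eq_fun do rewrite (partial_sumE N0 NE)//.
apply: cvgB; last exact: remainder_cvg0.
have -> : (fun M => \sum_(1 <= m < 2 * M.+1) ((m == v %[mod q])%N)%:R * eta m) =
    (fun M => \sum_(j < ((2 * M).+1 + (q - v)) %/ q) eta (q * j + v)).
  apply/funext => M; rewrite -sum_residue// [in RHS]big_mkcond/=.
  have -> : (2 * M.+1 = (2 * M).+2)%N by lia.
  by apply: eq_bigr => m _; case: ifP => _; rewrite ?mul1r ?mul0r.
(* The number of terms tends to infinity with M, so this is a reindexing of the convergent sum over
   the class. *)
apply: (@cvg_comp _ _ _ (fun M => ((2 * M).+1 + (q - v)) %/ q)%N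
  (fun n => \sum_(j < n) eta (q * j + v)) _ \oo); last exact: sum_eta_cvg.
apply/cvgnyPge => a; near=> M; rewrite leq_divRL//.
have : (a * q <= M)%N by near: M; exact: nbhs_infty_ge.
by lia.
Unshelve. all: by end_near. Qed.

(** The sums in [digamma_seq] at x and x + 1 differ by their end terms, of which the last tends to
    0. *)
Lemma PsiS (x : R) : 0 < x -> Psi (x + 1) = Psi x + x^-1.
Proof.
move=> x0.
have d0 : (x + n.+1%:R)^-1 @[n --> \oo] --> (0 : R).
  apply: (@squeeze_cvgr _ _ _ _ (fun=> 0) (fun n => n.+1%:R^-1)).
  - near=> n; have n0 : 0 < n.+1%:R :> R by rewrite ltr0n.
    rewrite invr_ge0 addr_ge0 ?(ltW x0)//= lef_pV2 ?posrE//; first lra.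
    by rewrite addr_gt0.
  - exact: cvg_cst.
  - exact: cvg_harmonic.
have c1 := digamma_seq_cvgPsi (addr_gt0 x0 ltr01).
apply: (cvg_unique _ c1); first exact: Rhausdorff.
have -> : (fun n => digamma_seq n (x + 1)) = fun n => digamma_seq n x + x^-1 - (x + n.+1%:R)^-1.
  apply/funext => n; rewrite /digamma_seq big_ord_recr/= [in RHS]big_ord_recl/= addr0.
  have -> : \sum_(i < n) (x + (bump 0 i)%:R)^-1 = \sum_(i < n) (x + 1 + i%:R)^-1.
    by apply: eq_bigr => i _; rewrite -addrA nat1r.
  by rewrite -[x + 1 + n%:R]addrA nat1r; ring.
rewrite -[Psi x + _]subr0; apply: cvgB => //.
by apply: cvgD; [exact: digamma_seq_cvgPsi|exact: cvg_cst].
Unshelve. all: by end_near. Qed.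

Lemma Psi1 : Psi (1 : R) = - euler_gamma R.
Proof.
apply: (cvg_unique _ (digamma_seq_cvgPsi ltr01)); first exact: Rhausdorff.
by apply/cvgNP; rewrite opprK; exact: euler_gamma_cvg.
Qed.

End EtaSeries.

Theorem theorem2 (R : realType) (w : seq bool) (w_nonempty : w <> [::]) :
  (v2 w = 0%N ->
    (fun M : nat => \sum_(1 <= n < M) ((block_count w n)%:R : R) /
       (2 * n%:R * (2 * n%:R + 1) * (2 * n%:R + 2))) @ \oo -->
      ln (Gamma ((1 : R) / 2 ^+ size w))
      + euler_gamma R / 2 ^+ (size w).+1
      - (size w)%:R * ln (2 : R)
      - 1 / 2 ^+ (size w).+1 * Psi ((1 : R) / 2 ^+ size w)
      - 1 / 2)
  /\
  (v2 w <> 0%N ->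
    (fun M : nat => \sum_(1 <= n < M) ((block_count w n)%:R : R) /
       (2 * n%:R * (2 * n%:R + 1) * (2 * n%:R + 2))) @ \oo -->
      ln (Gamma (((v2 w)%:R + 1 : R) / 2 ^+ size w))
      - ln (Gamma ((v2 w)%:R / 2 ^+ size w : R))
      - 1 / 2 ^+ (size w).+1 *
        (Psi ((v2 w)%:R / 2 ^+ size w : R)
         + Psi (((v2 w)%:R + 1 : R) / 2 ^+ size w))).
Proof.
have w0 : w != [::] by exact/eqP.
have -> : (fun M : nat => \sum_(1 <= n < M) ((block_count w n)%:R : R) /
       (2 * n%:R * (2 * n%:R + 1) * (2 * n%:R + 2))) =
    (fun M : nat => \sum_(1 <= n < M) ((count_digits w n)%:R : R) /
       (2 * n%:R * (2 * n%:R + 1) * (2 * n%:R + 2))).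
  apply/funext => M; apply: eq_big_nat => n /andP[n0 _].
  by rewrite block_countE.
have N5 m := count_digits_sqr m w0.
set q := (2 ^ size w)%N.
have vq : (v2 w < q)%N by exact: v2_lt.
have q0 : (0 < q)%N by lia.
have qE : 2 ^+ size w = q%:R :> R by rewrite natrX.
have qR : 0 < q%:R :> R by rewrite ltr0n.
split=> [vw0|/eqP vw0].
  have := @block_series_cvg R (count_digits w) q q _ (count_digits0 w) N5.
  rewrite q0 leqnn => /(_ isT).
  have NE m : (0 < m)%N -> count_digits w m = (count_digits w m./2 + (m == q %[mod q])%N)%N.
    by move=> m0; rewrite count_digits_half// vw0 modnn.
  have e1 : q%:R / q%:R = 1 :> R by rewrite divff// gt_eqF.
  have e2 : q.+1%:R / q%:R = 1 / q%:R + 1 :> R by rewrite -nat1r mulrDl e1.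
  move=> /(_ NE); congr (_ --> _); rewrite exprS qE e1 e2.
  have iq : 0 < 1 / q%:R :> R by rewrite divr_gt0.
  (* Shifting 1/q + 1 down to 1/q produces ln (1/q) = -|w| log 2 from Gamma, and q from Psi, which
     times -1/(2q) is the constant -1/2. *)
  rewrite PsiS// GammaS// lnM ?posrE ?Gamma_gt0// Psi1 Gamma1 ln1.
  have -> : ln (1 / q%:R) = - (size w)%:R * ln 2 :> R.
    by rewrite div1r lnV ?posrE// -qE lnXn// mulNr mulr_natl.
  move: (ln (Gamma _)) (ln _) (Psi _) (euler_gamma _) => a b c d.
  by field; rewrite gt_eqF.
have := @block_series_cvg R (count_digits w) q (v2 w) _ (count_digits0 w) N5.
rewrite lt0n vw0 (ltnW vq) => /(_ isT).
have NE m : (0 < m)%N -> count_digits w m = (count_digits w m./2 + (m == v2 w %[mod q])%N)%N.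
  by move=> m0; rewrite count_digits_half// (modn_small vq).
by move=> /(_ NE); rewrite exprS qE natr1.
Qed.
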